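(* Let $\sigma$ be the uniform distribution on $\{0,1\}^n$, let $\mathcal D_\emptyset$ be a distribution on $\{\pm1\}^N$, and let $\mathcal J_\emptyset=\sigma\times\mathcal D_\emptyset$. Let $\mathcal J_*$ be a distribution on pairs $(x,y)\in\{0,1\}^n\times\{\pm1\}^N$ supported within the support of $\mathcal J_\emptyset$, with relative density $\mu_*(x,y)=\Pr_{\mathcal J_*}(x,y)/\Pr_{\mathcal J_\emptyset}(x,y)$. For $d,D\in\mathbb N$ let $\Pi_{d,D}$ be the orthogonal projection in $L_2(\mathcal J_\emptyset)$ onto $V_{d,D}=\mathrm{span}\{q\in\mathbb R[x,y]:\deg_x q\le d,\ \deg_y q\le D\}$, and define the $D$-pseudocalibrated function $\bar\mu_y(x)=(\Pi_{d,D}\mu_* )(x,y)$. Let $p(x,y)$ be a polynomial such that $p(x,y)=0$ for every $(x,y)$ in the support of $\mathcal J_*$, and let $B=\max_{(x,y)\in\mathrm{supp}(\mathcal J_\emptyset)}|p(x,y)|$, $D_y=\deg_y(p)$, $d_x=\deg_x(p)$. If $d\ge d_x$, then for every $\epsilon>0$, $$\Pr_{y\sim\mathcal D_\emptyset}\Big[\big|\mathbb E_{x\sim\sigma}\,p(x,y)\,\bar\mu_y(x)\big|\ge\epsilon\Big]\le\frac{B^2}{\epsilon^2}\cdot\big\|\Pi_{d,D+2D_y}\mu_*-\Pi_{d,D-1}\mu_*\big\|_{2,\mathcal J_\emptyset}^2.$$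
   Context: $L_2(\mathcal J_\emptyset)$ is the space of real functions of $(x,y)$ with inner product $\langle f,g\rangle=\mathbb E_{(x,y)\sim\mathcal J_\emptyset}f(x,y)g(x,y)$, and $\|f\|_{2,\mathcal J_\emptyset}=\langle f,f\rangle^{1/2}$. $\deg_x$ and $\deg_y$ denote the degree in the $x$ variables and in the $y$ variables respectively. *)

(* Defs.v *)
From HB Require Import structures.
From mathcomp Require Import all_boot all_order all_algebra.
From mathcomp Require Import reals.
From mathcomp Require Import mpoly.
From Stdlib Require Import ClassicalEpsilon.

Set Implicit Arguments.
Unset Strict Implicit.
Unset Printing Implicit Defensive.

Import Order.TTheory GRing.Theory Num.Theory.
Local Open Scope ring_scope.

Record distr (R : realType) (T : finType) := Distr {
  pmf :> {ffun T -> R};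
  pmf_ge0 : forall t, 0 <= pmf t;
  pmf_sum1 : \sum_t pmf t = 1 }.

Definition supp (R : realType) (T : finType) (P : distr R T) : pred T :=
  [pred t | P t != 0].

Definition Pr (R : realType) (T : finType) (P : distr R T) (A : pred T) : R :=
  \sum_(t | A t) P t.

Definition Ex (R : realType) (T : finType) (P : distr R T) (f : T -> R) : R :=
  \sum_t P t * f t.

Lemma prod_pmf_ge0 (R : realType) (S T : finType)
    (P : distr R S) (Q : distr R T) (z : S * T) :
  0 <= [ffun z : S * T => P z.1 * Q z.2] z.
Proof. by rewrite ffunE mulr_ge0 ?pmf_ge0. Qed.

Lemma prod_pmf_sum1 (R : realType) (S T : finType)
    (P : distr R S) (Q : distr R T) :
  \sum_z [ffun z : S * T => P z.1 * Q z.2] z = 1.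
Proof.
under eq_bigr => z _ do rewrite ffunE.
rewrite -(pair_bigA _ (fun s t => P s * Q t)) /=.
under eq_bigr => s _ do rewrite -mulr_sumr pmf_sum1 mulr1.
exact: pmf_sum1.
Qed.

Definition prod_distr (R : realType) (S T : finType)
    (P : distr R S) (Q : distr R T) : distr R (S * T)%type :=
  Distr (prod_pmf_ge0 P Q) (prod_pmf_sum1 P Q).

(** An element of {±1}^N is stored by its sign bits: the bit [b] stands for
    [(-1) ^+ b]; see [point].  *)
Definition cube (n : nat) : finType := {ffun 'I_n -> bool}.

Lemma uniform_ge0 (R : realType) (n : nat) (x : cube n) :
  0 <= [ffun _ : cube n => #|cube n|%:R^-1 : R] x.
Proof. by rewrite ffunE invr_ge0 ler0n. Qed.

Lemma uniform_sum1 (R : realType) (n : nat) :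
  \sum_x [ffun _ : cube n => #|cube n|%:R^-1 : R] x = 1.
Proof.
under eq_bigr => x _ do rewrite ffunE.
rewrite sumr_const -[_ *+ _]mulr_natl mulfV // pnatr_eq0 -lt0n.
by apply/card_gt0P; exists [ffun=> false].
Qed.

Definition uniform (R : realType) (n : nat) : distr R (cube n) :=
  Distr (@uniform_ge0 R n) (@uniform_sum1 R n).

(** In {mpoly R[n + N]}, variable [lshift N i] is x_i and variable
    [rshift n j] is y_j. *)

Section Poly.
Variables (R : realType) (n N : nat).

Definition mdegx (m : 'X_{1..n + N}) : nat := (\sum_(i < n) m (lshift N i))%N.
Definition mdegy (m : 'X_{1..n + N}) : nat := (\sum_(j < N) m (rshift n j))%N.

(** For [p = 0] these are 0 rather than -oo. *)
Definition degx (p : {mpoly R[n + N]}) : nat :=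
  (\max_(m <- msupp p) mdegx m)%N.
Definition degy (p : {mpoly R[n + N]}) : nat :=
  (\max_(m <- msupp p) mdegy m)%N.

Definition point (z : cube n * cube N) : 'I_(n + N) -> R :=
  fun k => match split k with
           | inl i => (z.1 i)%:R
           | inr j => (-1) ^+ z.2 j
           end.

Definition pfun (p : {mpoly R[n + N]}) : {ffun cube n * cube N -> R} :=
  [ffun z => p.@[point z]].

(** The y-bound is an integer because the bound D - 1 is -1 when D = 0; only
    [q = 0] satisfies that bound, in accordance with the convention that 0 has
    degree -oo.  The polynomials of bounded degree already form a linear space,
    which is its own span. *)
Definition Vdeg (d : nat) (D : int) (f : {ffun cube n * cube N -> R}) : Prop :=
  exists q : {mpoly R[n + N]},
    [/\ (forall m : 'X_{1..n + N}, m \in msupp q -> (mdegx m <= d)%N),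
        (forall m : 'X_{1..n + N}, m \in msupp q -> (mdegy m)%:Z <= D) &
        f = pfun q].

End Poly.

Section L2.
Variables (R : realType) (T : finType) (J : distr R T).

Definition inner (f g : {ffun T -> R}) : R := Ex J (fun z => f z * g z).

Definition norm2 (f : {ffun T -> R}) : R := Num.sqrt (inner f f).

Definition is_orthproj (V : {ffun T -> R} -> Prop) (f g : {ffun T -> R}) :=
  V g /\ forall v, V v -> inner (f - g) v = 0.

(** Elements of L_2(J) are functions up to equality on the support of J, so
    [is_orthproj V f] determines [g] only on the support ([is_orthproj_uniq]);
    [orthproj V f] is an arbitrary representative of that class. *)
Definition orthproj (V : {ffun T -> R} -> Prop) (f : {ffun T -> R}) :
    {ffun T -> R} :=
  epsilon (inhabits 0) (is_orthproj V f).

Lemma innerC f g : inner f g = inner g f.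
Proof. by apply: eq_bigr => z _; rewrite [f z * _]mulrC. Qed.

Lemma innerDl f g h : inner (f + g) h = inner f h + inner g h.
Proof.
rewrite /inner /Ex -big_split /=; apply: eq_bigr => z _.
by rewrite ffunE mulrDl mulrDr.
Qed.

Lemma innerZl a (f h : {ffun T -> R^o}) : inner (a *: f) h = a * inner f h.
Proof.
rewrite /inner /Ex mulr_sumr; apply: eq_bigr => z _.
by rewrite ffunE -mulrA mulrCA.
Qed.

Lemma innerDr f g h : inner h (f + g) = inner h f + inner h g.
Proof. by rewrite innerC innerDl !(innerC h). Qed.

Lemma innerZr a (f h : {ffun T -> R^o}) : inner h (a *: f) = a * inner h f.
Proof. by rewrite innerC innerZl (innerC h). Qed.

Lemma innerBl f g h : inner (f - g) h = inner f h - inner g h.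
Proof. by rewrite innerDl -(@scaleN1r R {ffun T -> R^o}) innerZl mulN1r. Qed.

Lemma inner_null f : inner f f = 0 -> forall z, z \in supp J -> f z = 0.
Proof.
move=> /eqP; rewrite psumr_eq0 => [/allP H z|z _]; last first.
  by rewrite mulr_ge0 ?pmf_ge0 // -expr2 sqr_ge0.
rewrite inE => Jz; have := H z (mem_index_enum _).
by rewrite !mulf_eq0 (negbTE Jz) /= orbb => /eqP.
Qed.

Lemma inner_null_l f h : inner f f = 0 -> inner f h = 0.
Proof.
move=> f0; rewrite /inner /Ex big1 // => z _.
have [->|Jz] := eqVneq (J z) 0; first by rewrite mul0r.
by rewrite (inner_null f0) ?mul0r ?mulr0.
Qed.

Lemma is_orthproj_uniq (V : {ffun T -> R} -> Prop) f g h :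
    (forall u v, V u -> V v -> V (u - v)) ->
  is_orthproj V f g -> is_orthproj V f h ->
  forall z, z \in supp J -> g z = h z.
Proof.
move=> VB [Vg fg] [Vh fh] z Jz; apply/eqP; rewrite -subr_eq0.
suff /inner_null /(_ z Jz) : inner (g - h) (g - h) = 0.
  by rewrite !ffunE => ->.
have Vgh := VB _ _ Vg Vh.
have {1}-> : g - h = (f - h) - (f - g) by rewrite [RHS]addrC opprB addrA subrK.
by rewrite innerBl fg // fh // subrr.
Qed.

Lemma span_orthproj (s : seq {ffun T -> R^o}) (f : {ffun T -> R^o}) :
  exists2 g, g \in <<s>>%VS & forall v, v \in <<s>>%VS -> inner (f - g) v = 0.
Proof.
elim: s f => [|u s IHs] f.
  exists 0; first exact: mem0v.
  move=> v; rewrite span_nil memv0 => /eqP->.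
  by rewrite -(scale0r (0 : {ffun T -> R^o})) innerZr mul0r.
have [u1 u1s u1P] := IHs u; have [f1 f1s f1P] := IHs f.
set w := u - u1 in u1P.
have sub : (<<s>> <= <<u :: s>>)%VS by rewrite span_cons addvSr.
have wS : w \in <<u :: s>>%VS.
  by apply: rpredB; [exact/memv_span/mem_head|exact: (subvP sub)].
exists (f1 + (inner f w / inner w w) *: w).
  by apply: rpredD; [exact: (subvP sub)|exact: rpredZ].
move=> v; rewrite span_cons => /memv_addP [_ /vlineP [a ->] [t ts ->]].
have -> : a *: u + t = a *: w + (a *: u1 + t).
  by rewrite addrA -scalerDr subrK.
have {ts} ts : a *: u1 + t \in <<s>>%VS by rewrite rpredD ?rpredZ.
have w1 : inner w w = 0 -> inner f w = 0.
  by move=> w0; rewrite innerC inner_null_l.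
rewrite opprD addrA innerDr innerZr !(innerBl (f - f1)) (f1P _ ts) innerBl !innerZl.
rewrite (innerC f1) (u1P _ f1s) (u1P _ ts) mulr0 !subr0 addr0.
have [w0|w0] := eqVneq (inner w w) 0; last by rewrite divfK ?subrr ?mulr0.
by rewrite w1 // w0 mulr0 subr0 mulr0.
Qed.

End L2.

Lemma orthproj_Vdeg (R : realType) (n N : nat)
    (J : distr R (cube n * cube N)%type) (d : nat) (D : int) f :
  is_orthproj J (Vdeg d D) f (orthproj J (Vdeg d D) f).
Proof.
apply: epsilon_spec.
pose K := (d + `|D|).+1%N.
pose ok := [pred m : bmultinom (n + N) K |
  (mdegx (bmnm m) <= d)%N && ((mdegy (bmnm m))%:Z <= D)].
pose e (m : bmultinom (n + N) K) :=
  pfun ('X_[bmnm m] : {mpoly R[n + N]}) : {ffun cube n * cube N -> R^o}.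
have pfunB : linear (@pfun R n N : _ -> {ffun cube n * cube N -> R^o}).
  by move=> a p q; apply/ffunP => z; rewrite !ffunE mevalD mevalZ.
have VS v : Vdeg d D v <-> v \in <<[seq e m | m in ok]>>%VS.
  split=> [[q [qx qy ->]]|].
    rewrite (mpolyE q).
    have -> (s : seq _) (F : 'X_{1..n + N} -> R) :
        pfun (\sum_(m <- s) F m *: 'X_[m]) =
        \sum_(m <- s) F m *: (pfun 'X_[m] : {ffun cube n * cube N -> R^o}).
      elim: s => [|m s IHs].
        by rewrite !big_nil; apply/ffunP=> z; rewrite !ffunE meval0.
      by rewrite !big_cons pfunB IHs.
    rewrite big_seq; apply: rpred_sum => m mq; apply: rpredZ.
    have mK : (mdeg m < K)%N.
      rewrite ltnS mdegE big_split_ord /= leq_add ?qx //.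
      by rewrite -lez_nat; apply: le_trans (qy _ mq) _; rewrite abszE ler_norm.
    apply: memv_span; apply/imageP; exists (BMultinom mK) => //.
    by rewrite inE /= qx ?qy.
  move=> /coord_span ->; rewrite -[X in Vdeg _ _ X]big_enum.
  elim: (enum _) => [|i s [q [qx qy qE]]].
    rewrite big_nil; exists 0; split; rewrite ?msupp0 //.
    by apply/ffunP=> z; rewrite !ffunE meval0.
  rewrite big_cons qE.
  set c := coord _ _ _.
  have : (image_tuple e ok)`_i \in [seq e m | m in ok].
    by rewrite mem_nth // size_tuple.
  case/imageP=> m okm ->.
  exists (c *: 'X_[m] + q); rewrite pfunB; split=> // k.
    move=> /msuppD_le; rewrite mem_cat => /orP [/msuppZ_le|/qx //].
    by rewrite msuppX inE => /eqP->; case/andP: okm.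
  move=> /msuppD_le; rewrite mem_cat => /orP [/msuppZ_le|/qy //].
  by rewrite msuppX inE => /eqP->; case/andP: okm.
have [g gS gP] := span_orthproj J [seq e m | m in ok] f.
by exists g; split=> [|v /VS]; [exact/VS|exact: gP].
Qed.

(** Off the support of [J0] the quotient is [_ / 0 = 0]; those values are
    irrelevant in L_2(J0). *)
Definition rel_density (R : realType) (T : finType) (Js J0 : distr R T) :
    {ffun T -> R} :=
  [ffun z => Js z / J0 z].

Definition Pi (R : realType) (n N : nat) (J0 : distr R (cube n * cube N)%type)
    (d : nat) (D : int) (f : {ffun cube n * cube N -> R}) :
    {ffun cube n * cube N -> R} :=
  orthproj J0 (Vdeg d D) f.

Definition mubar (R : realType) (n N : nat)
    (J0 Js : distr R (cube n * cube N)%type) (d D : nat)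
    (y : cube N) (x : cube n) : R :=
  Pi J0 d D%:Z (rel_density Js J0) (x, y).

Definition max_abs (R : realType) (T : finType) (P : distr R T)
    (f : T -> R) : R :=
  \big[Num.max/0]_(z | z \in supp P) `|f z|.

(* Main.v *)
Require Import Defs.
From mathcomp Require Import all_boot all_order all_algebra.
From mathcomp Require Import reals.
From mathcomp Require Import mpoly.
From mathcomp Require Import zify ring lra.

(** Put [g y = E_x p(x, y) mubar_y(x)] and [G (x, y) = g y].  As [mubar] lies in
    [V_{d,D}], [g] is a polynomial in [y] of degree at most [D + D_y], so that
    [p G] lies in [V_{d,D+2D_y}].  Since [p mu_* = 0], [p G] is orthogonal to
    [mu_*], hence to its projection [a] on [V_{d,D+2D_y}].  With [b] the
    projection on [V_{d,D}] this gives [|g|^2 = <p G, b> = <p G, b - a>], which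
    is at most [(|g|^2 + B^2 |a - b|^2) / 2].  Thus
    [|g|^2 <= B^2 |a - b|^2]; conclude by Pythagoras and Chebyshev. *)

Import Order.TTheory GRing.Theory Num.Theory.
Local Open Scope ring_scope.

(** * Expectations on finite spaces and nested orthogonal projections *)

Section Expectation.
Context {R : realType} {T : finType}.
Implicit Types (P : distr R T) (f g : T -> R).

Lemma eq_Ex_supp P f g : {in supp P, f =1 g} -> Ex P f = Ex P g.
Proof.
move=> fg; apply: eq_bigr => t _.
have [->|Pt] := eqVneq (P t) 0; first by rewrite !mul0r.
by rewrite fg.
Qed.

Lemma ler_Ex_supp P f g : {in supp P, forall t, f t <= g t} -> Ex P f <= Ex P g.
Proof.
move=> fg; apply: ler_sum => t _.
have [->|Pt] := eqVneq (P t) 0; first by rewrite !mul0r.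
by rewrite ler_wpM2l ?pmf_ge0 ?fg.
Qed.

Lemma chebyshev P f (eps : R) : 0 < eps ->
  Pr P [pred t | eps <= `|f t|] <= Ex P (fun t => f t ^+ 2) / eps ^+ 2.
Proof.
move=> e0; rewrite ler_pdivlMr ?exprn_gt0 // /Pr /Ex big_distrl big_mkcond /=.
apply: ler_sum => t _; case: ifP => [et|_]; last first.
  by rewrite mulr_ge0 ?pmf_ge0 ?sqr_ge0.
rewrite ler_wpM2l ?pmf_ge0 // -(real_normK (num_real (f t))).
by rewrite lerXn2r ?nnegrE // ltW.
Qed.

Lemma max_abs_ge P f : {in supp P, forall t, `|f t| <= max_abs P f}.
Proof. by move=> t Pt; apply: (le_bigmax_cond 0 (fun t => `|f t|) Pt). Qed.

Lemma Ex_prod {S : finType} (P : distr R S) (Q : distr R T) (f : S * T -> R) :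
  Ex (prod_distr P Q) f = Ex Q (fun t => Ex P (fun s => f (s, t))).
Proof.
rewrite /Ex; under [RHS]eq_bigr => t _ do rewrite mulr_sumr.
rewrite exchange_big pair_bigA; apply: eq_bigr => -[s t] _ /=.
by rewrite ffunE /= mulrA [Q t * _]mulrC.
Qed.

Lemma norm2_sqr P (f : {ffun T -> R}) : norm2 P f ^+ 2 = inner P f f.
Proof.
rewrite sqr_sqrtr // sumr_ge0 // => t _.
by rewrite mulr_ge0 ?pmf_ge0 // -expr2 sqr_ge0.
Qed.

(** The residuals [f - a] and [f - b] are both orthogonal to [V], the first because [V] sits inside
    [W]; hence so is their difference [a - b], whereas [b - c] lies in [V]. *)
Lemma orthproj_pythagoras P (U V W : {ffun T -> R} -> Prop)
    (f a b c : {ffun T -> R}) :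
    (forall u, U u -> V u) -> (forall v, V v -> W v) ->
    (forall u v, V u -> V v -> V (u - v)) ->
    is_orthproj P U f c -> is_orthproj P V f b -> is_orthproj P W f a ->
  norm2 P (a - c) ^+ 2 = norm2 P (a - b) ^+ 2 + norm2 P (b - c) ^+ 2.
Proof.
move=> UV VW VB [Uc _] [Vb bP] [Wa aP]; rewrite !norm2_sqr.
have Vbc : V (b - c) by apply: VB => //; apply: UV.
have abc : inner P (a - b) (b - c) = 0.
  have -> : a - b = (f - b) - (f - a) by rewrite [RHS]addrC opprB addrA subrK.
  by rewrite innerBl bP // aP ?subrr //; apply: VW.
have -> : a - c = (a - b) + (b - c) by rewrite addrA subrK.
move: (a - b) (b - c) abc => u v uv0.
by rewrite innerDl !innerDr (innerC P v u) uv0 addr0 add0r.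
Qed.

End Expectation.

(** * Closure properties of the spaces of bounded degree *)

Section DegreeSpaces.
Context {R : realType} {n N : nat}.
Implicit Types (f g : {ffun cube n * cube N -> R}) (d : nat) (D : int).

Lemma Vdeg_le d1 d2 D1 D2 f :
  (d1 <= d2)%N -> D1 <= D2 -> Vdeg d1 D1 f -> Vdeg d2 D2 f.
Proof.
move=> d12 D12 [q [qx qy ->]]; exists q; split=> // m mq.
  exact: leq_trans (qx m mq) d12.
exact: le_trans (qy m mq) D12.
Qed.

Lemma Vdeg_pfun (q : {mpoly R[n + N]}) : Vdeg (degx q) (degy q)%:Z (pfun q).
Proof.
by exists q; split=> // m mq; rewrite ?lez_nat; apply: leq_bigmax_seq mq _.
Qed.

Lemma Vdeg_comb d D a f g :
  Vdeg d D f -> Vdeg d D g -> Vdeg d D [ffun z => a * f z + g z].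
Proof.
move=> [q [qx qy ->]] [r [rx ry ->]]; exists (a *: q + r); split.
- by move=> m /msuppD_le; rewrite mem_cat => /orP [/msuppZ_le|] /=; auto.
- by move=> m /msuppD_le; rewrite mem_cat => /orP [/msuppZ_le|] /=; auto.
- by apply/ffunP=> z; rewrite !ffunE mevalD mevalZ.
Qed.

Lemma Vdeg_sub d D f g : Vdeg d D f -> Vdeg d D g -> Vdeg d D (f - g).
Proof.
move=> Vf Vg; have -> : f - g = [ffun z => -1 * g z + f z].
  by apply/ffunP=> z; rewrite !ffunE mulN1r addrC.
exact: Vdeg_comb.
Qed.

Lemma Vdeg_mul d1 d2 D1 D2 f g : Vdeg d1 D1 f -> Vdeg d2 D2 g ->
  Vdeg (d1 + d2) (D1 + D2) [ffun z => f z * g z].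
Proof.
move=> [q [qx qy ->]] [r [rx ry ->]]; exists (q * r); split.
- move=> m /msuppM_le /allpairsP [[m1 m2] /= [m1q m2r ->]].
  rewrite /mdegx; under eq_bigr => i _ do rewrite mnmDE.
  by rewrite big_split leq_add ?qx ?rx.
- move=> m /msuppM_le /allpairsP [[m1 m2] /= [m1q m2r ->]].
  rewrite /mdegy; under eq_bigr => i _ do rewrite mnmDE.
  by rewrite big_split PoszD lerD ?qy ?ry.
- by apply/ffunP=> z; rewrite !ffunE mevalM.
Qed.

Lemma Vdeg_sum d D {I : eqType} (s : seq I) (a : I -> R)
    (F : I -> {ffun cube n * cube N -> R}) :
    {in s, forall i, Vdeg d D (F i)} ->
  Vdeg d D [ffun z => \sum_(i <- s) a i * F i z].
Proof.
elim: s => [|i s IHs] VF.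
  exists 0; split; rewrite ?msupp0 //.
  by apply/ffunP=> z; rewrite !ffunE big_nil meval0.
have -> : [ffun z => \sum_(j <- i :: s) a j * F j z] =
    [ffun z => a i * F i z + [ffun z => \sum_(j <- s) a j * F j z] z].
  by apply/ffunP=> z; rewrite !ffunE big_cons.
apply: Vdeg_comb; first by apply: VF; rewrite mem_head.
by apply: IHs => j js; apply: VF; rewrite inE js orbT.
Qed.

Lemma pfunX (m : 'X_{1..n + N}) x y :
  pfun ('X_[m] : {mpoly R[n + N]}) (x, y) =
  \prod_(i < n) (x i)%:R ^+ m (lshift N i) *
  \prod_(j < N) (-1) ^+ (y j) ^+ m (rshift n j).
Proof.
rewrite ffunE mevalX big_split_ord /=; congr (_ * _).
  apply: eq_bigr => i _.
  (* [lshift N i] is convertible to [unsplit (inl i)], so [unsplitK] resolves the case split in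
     [point]. *)
  by rewrite /point -[X in split X]/(unsplit (inl i)) unsplitK.
apply: eq_bigr => j _.
by rewrite /point -[X in split X]/(unsplit (inr j)) unsplitK.
Qed.

(** Each monomial is an x-factor times a y-factor. Averaging over [x] turns the former into a
    constant and leaves the latter alone. *)
Lemma Vdeg_Ex_x (P : distr R (cube n)) d D f : Vdeg d D f ->
  Vdeg 0 D [ffun z : cube n * cube N => Ex P (fun x => f (x, z.2))].
Proof.
move=> [q [_ qy ->]].
(* [my m] erases the x-exponents of [m]; below, [c m] is the mean of the erased factor. *)
pose my (m : 'X_{1..n + N}) : 'X_{1..n + N} :=
  [multinom if split k is inl _ then 0%N else m k | k < n + N].
have myl m i : my m (lshift N i) = 0%N.
  by rewrite mnmE -[lshift N i]/(unsplit (inl i)) unsplitK.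
have myr m j : my m (rshift n j) = m (rshift n j).
  by rewrite mnmE -[X in split X]/(unsplit (inr j)) unsplitK.
pose c m := Ex P (fun x => \prod_(i < n) (x i)%:R ^+ m (lshift N i)).
have -> : [ffun z : cube n * cube N => Ex P (fun x => pfun q (x, z.2))] =
    [ffun z => \sum_(m <- msupp q)
      (q@_m * c m) * pfun ('X_[my m] : {mpoly R[n + N]}) z].
  apply/ffunP=> -[x0 y]; rewrite !ffunE /=.
  have -> : Ex P (fun x => pfun q (x, y)) = Ex P (fun x =>
      \sum_(m <- msupp q) q@_m * pfun ('X_[m] : {mpoly R[n + N]}) (x, y)).
    apply: eq_bigr => x _; congr (_ * _); rewrite ffunE mevalE.
    by apply: eq_bigr => m _; rewrite ffunE mevalX.
  rewrite {1}/Ex; under [LHS]eq_bigr => x _ do rewrite mulr_sumr.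
  rewrite exchange_big; apply: eq_bigr => m _ /=.
  rewrite pfunX [X in _ * (X * _)]big1 => [|i _]; last by rewrite myl expr0.
  under [in RHS]eq_bigr => j _ do rewrite myr.
  rewrite mul1r -mulrA big_distrl mulr_sumr /=; apply: eq_bigr => x _.
  by rewrite pfunX !mulrA [_ * q@_m]mulrC.
apply: (Vdeg_sum _ _ _ _ (fun m => pfun 'X_[my m])) => m mq; exists 'X_[my m]; split=> // k.
  rewrite msuppX inE => /eqP->.
  by rewrite /mdegx big1.
rewrite msuppX inE => /eqP->; rewrite /mdegy.
by under eq_bigr => j _ do rewrite myr; apply: qy.
Qed.

End DegreeSpaces.

(** * Orthogonality to the density and the resulting tail bound *)

Lemma inner_rel_density_eq0 {R : realType} {T : finType} (Js J0 : distr R T)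
    (f : {ffun T -> R}) :
  (forall t, t \in supp Js -> f t = 0) -> inner J0 f (rel_density Js J0) = 0.
Proof.
move=> f0; rewrite /inner /Ex big1 // => t _; rewrite ffunE.
(* Where [Js] is zero the density vanishes; everywhere else [f] does. *)
have [->|Jt] := eqVneq (Js t) 0; first by rewrite mul0r !mulr0.
by rewrite f0 // mul0r mulr0.
Qed.

(** This is the sharper form of the bound, with the projection at [D] itself subtracted; passing to
    [D - 1] only enlarges the norm. *)
Lemma second_moment_bound {R : realType} {n N : nat}
    (D0 : distr R (cube N)) (Js : distr R (cube n * cube N)%type)
    (d D : nat) (p : {mpoly R[n + N]}) :
  let sigma := uniform R n in
  let J0 := prod_distr sigma D0 in
  let mus := rel_density Js J0 in
  (forall z, z \in supp Js -> pfun p z = 0) ->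
  (degx p <= d)%N ->
  Ex D0 (fun y => Ex sigma (fun x => pfun p (x, y) * mubar J0 Js d D y x) ^+ 2)
  <= max_abs J0 (pfun p) ^+ 2
     * norm2 J0 (Pi J0 d (D%:Z + 2 * (degy p)%:Z) mus - Pi J0 d D%:Z mus) ^+ 2.
Proof.
move=> sigma J0 mus p0 dx.
set a := Pi J0 d _ mus; set b := Pi J0 d D%:Z mus; set B := max_abs _ _.
have [Vb bP] : is_orthproj J0 (Vdeg d D%:Z) mus b := orthproj_Vdeg J0 d _ mus.
have [Va aP] := orthproj_Vdeg J0 d (D%:Z + 2 * (degy p)%:Z) mus.
rewrite -/(Pi _ _ _ _) -/a in Va aP.
pose g y := Ex sigma (fun x => pfun p (x, y) * mubar J0 Js d D y x).
pose G : {ffun cube n * cube N -> R} := [ffun z => g z.2].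
pose pG : {ffun cube n * cube N -> R} := [ffun z => pfun p z * G z].
have VG : Vdeg 0 ((degy p)%:Z + D%:Z) G.
  have -> : G = [ffun z : cube n * cube N =>
      Ex sigma (fun x => [ffun z => pfun p z * b z] (x, z.2))].
    apply/ffunP=> z; rewrite !ffunE.
    by apply: eq_bigr => x _; rewrite [in RHS]ffunE.
  exact: Vdeg_Ex_x (Vdeg_mul _ _ _ _ _ _ (Vdeg_pfun p) Vb).
(* Since [G] is free of [x], the x-degree stays at [degx p], which is at most [d]. One [degy p]
   comes from [G] and the other from the new factor [p]. *)
have VpG : Vdeg d (D%:Z + 2 * (degy p)%:Z) pG.
  apply: Vdeg_le (Vdeg_mul _ _ _ _ _ _ (Vdeg_pfun p) VG); first by rewrite addn0.
  lia.
have pGmus : inner J0 pG mus = 0.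
  by apply: inner_rel_density_eq0 => z /p0 pz; rewrite ffunE pz mul0r.
have pGa : inner J0 pG a = 0.
  have := aP _ VpG; rewrite innerBl !(innerC J0 _ pG) pGmus sub0r => /eqP.
  by rewrite oppr_eq0 => /eqP.
have normg : Ex D0 (fun y => g y ^+ 2) = inner J0 G G.
  rewrite /inner Ex_prod; apply: eq_bigr => y _; congr (_ * _).
  (* The factor 1 is expanded into the total mass of [sigma], as [G] is constant in [x]. *)
  rewrite -[LHS]mul1r -(pmf_sum1 sigma) /Ex big_distrl; apply: eq_bigr => x _ /=.
  by rewrite [G _]ffunE expr2.
have pGb : inner J0 pG b = inner J0 G G.
  rewrite -normg /inner Ex_prod; apply: eq_bigr => y _; congr (_ * _).
  (* For fixed [y] one copy of [g y] is kept as the value of [G], and the other is unfolded into the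
     x-average of [p] times [b]. *)
  rewrite expr2 {2}/g /Ex mulr_sumr; apply: eq_bigr => x _.
  by rewrite [pG _]ffunE [G _]ffunE -[mubar _ _ _ _ _ _]/(b (x, y)) /=; ring.
rewrite normg norm2_sqr.
have : 2 * inner J0 G G <= inner J0 G G + B ^+ 2 * inner J0 (a - b) (a - b).
  have -> : 2 * inner J0 G G = Ex J0 (fun z => 2 * (pG z * (b - a) z)).
    transitivity (2 * inner J0 pG (b - a)).
      by rewrite [in RHS]innerC innerBl !(innerC J0 _ pG) pGb pGa subr0.
    by rewrite /inner /Ex mulr_sumr; apply: eq_bigr => z _; rewrite mulrCA.
  have -> : inner J0 G G + B ^+ 2 * inner J0 (a - b) (a - b) =
      Ex J0 (fun z => G z * G z + B ^+ 2 * ((a - b) z * (a - b) z)).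
    rewrite /inner /Ex mulr_sumr -big_split; apply: eq_bigr => z _ /=.
    by rewrite mulrDr [_ * (B ^+ 2 * _)]mulrCA.
  (* The comparison is made on the support of [J0] only, because [B] bounds [p] only there. *)
  apply: ler_Ex_supp => z Jz; rewrite [pG z]ffunE.
  have -> : (b - a) z = - (a - b) z by rewrite -opprB !ffunE.
  set P := pfun p z; set u := (a - b) z.
  have PB : P ^+ 2 * u ^+ 2 <= B ^+ 2 * u ^+ 2.
    have PB : `|P| <= B by apply: (max_abs_ge J0 (pfun p)).
    rewrite ler_wpM2r ?sqr_ge0 // -(real_normK (num_real P)).
    by rewrite lerXn2r ?nnegrE // (le_trans _ PB).
  (* Expanding this square gives [- 2 P u G <= P ^+ 2 u ^+ 2 + G ^+ 2], and [PB] replaces [P] by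
     [B]. *)
  have := sqr_ge0 (P * u + G z); nra.
lra.
Qed.

Theorem theorem3p3 (R : realType) (n N : nat)
    (D0 : distr R (cube N)) (Js : distr R (cube n * cube N)%type)
    (d D : nat) (p : {mpoly R[n + N]}) :
  let sigma := uniform R n in
  let J0 := prod_distr sigma D0 in
  let mus := rel_density Js J0 in
  let B := max_abs J0 (pfun p) in
  let Dy := degy p in
  let dx := degx p in
  (forall z, z \in supp Js -> z \in supp J0) ->
  (forall z, z \in supp Js -> pfun p z = 0) ->
  (dx <= d)%N ->
  forall eps : R, 0 < eps ->
    Pr D0 [pred y | `|Ex sigma (fun x => pfun p (x, y) * mubar J0 Js d D y x)|
                      >= eps]
    <= B ^+ 2 / eps ^+ 2
       * norm2 J0 (Pi J0 d (D%:Z + 2 * Dy%:Z) mus - Pi J0 d (D%:Z - 1) mus) ^+ 2.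
Proof.
move=> sigma J0 mus B Dy dx _ p0 dxd eps e0.
apply: le_trans (chebyshev _ _ _ e0) _.
rewrite mulrAC ler_wpM2r ?invr_ge0 ?sqr_ge0 //.
apply: le_trans (second_moment_bound D0 Js d D p p0 dxd) _.
rewrite ler_wpM2l ?sqr_ge0 //.
(* The y-bounds [D - 1 <= D <= D + 2 * Dy] give nested spaces, also for [D = 0], where the integer
   bound is -1. The error at [D - 1] is thus the error at [D] plus a square. *)
rewrite (orthproj_pythagoras J0 _ _ _ _ _ _ _ _ _ (Vdeg_sub d D%:Z)
  (orthproj_Vdeg J0 d (D%:Z - 1) mus) (orthproj_Vdeg J0 d D%:Z mus)
  (orthproj_Vdeg J0 d (D%:Z + 2 * Dy%:Z) mus)); first last.
- by move=> u; apply: Vdeg_le => //; lia.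
- by move=> u; apply: Vdeg_le => //; lia.
by rewrite lerDl sqr_ge0.
Qed.
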